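(* No strongly Cesàro bounded operator on a nonzero Banach space is chaotic. Moreover, no strongly Cesàro bounded operator on a nonzero Banach space is upper frequently hypercyclic (and hence none is frequently hypercyclic).
   Context: Let $X$ be a Banach space and $T$ a bounded linear operator on $X$; $\mathbb N_0=\{0,1,2,\dots\}$. $T$ is strongly Cesàro bounded if there is $C>0$ with $\sup_{n\ge1}\frac1n\sum_{k=0}^{n-1}|\langle x^*,T^kx\rangle|\le C\|x\|\|x^*\|$ for all $x\in X$, $x^*\in X^*$. $T$ is hypercyclic if there is $x\in X$ whose orbit $\{T^nx:n\in\mathbb N_0\}$ is dense in $X$. $T$ is chaotic if it is hypercyclic and $\{x\in X:T^nx=x\text{ for some }n\ge1\}$ is dense in $X$. For $A\subset\mathbb N_0$, the upper density is $\overline{\mathrm{dens}}(A)=\limsup_{N\to\infty}\frac{|A\cap\{0,\dots,N-1\}|}{N}$ and the lower density $\underline{\mathrm{dens}}(A)$ is the corresponding $\liminf$. For $x\in X$, $U\subset X$, put $N_T(x,U)=\{n\in\mathbb N_0:T^nx\in U\}$. $T$ is upper frequently hypercyclic (resp. frequently hypercyclic) if there is $x\in X$ such that $N_T(x,U)$ has positive upper (resp. lower) density for every nonempty open $U\subset X$. *)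

(* Defs.v *)
From mathcomp Require Export all_boot all_order all_algebra.
From mathcomp Require Export all_classical all_reals all_analysis.
From mathcomp Require Import complex.
Set Implicit Arguments.
Unset Strict Implicit.
Unset Printing Implicit Defensive.
Import Order.TTheory GRing.Theory Num.Theory.
Export numFieldNormedType.Exports.

Local Open Scope classical_set_scope.
Local Open Scope ring_scope.

Variant scalars := RealScalars | ComplexScalars.

Definition scalar_field (R : realType) (F : scalars) : numFieldType :=
  match F with
  | RealScalars => R
  | ComplexScalars => complex.complex R
  end.

Definition real_part (R : realType) (F : scalars) : scalar_field R F -> R :=
  match F with
  | RealScalars => id
  | ComplexScalars => @complex.Re R
  end.

(* The library's norm on a normed space over K takes its values in K, as
   nonnegative real elements; over the complex numbers [real_part] only
   changes its type. *)
Definition rnorm (R : realType) (F : scalars)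
    (V : normedModType (scalar_field R F)) (v : V) : R :=
  real_part `|v|.

Definition bounded_linear (R : realType) (F : scalars)
    (V W : normedModType (scalar_field R F)) (f : {linear V -> W}) : Prop :=
  exists M : R, forall x : V, rnorm (f x) <= M * rnorm x.

(* [sup] is junk (0) on unbounded sets: this is the norm of the dual space
   when f is bounded. *)
Definition dual_norm (R : realType) (F : scalars)
    (V : normedModType (scalar_field R F))
    (f : {linear V -> (scalar_field R F)^o}) : R :=
  sup [set rnorm (f x) | x in [set x : V | rnorm x <= 1]].

Definition strongly_cesaro_bounded (R : realType) (F : scalars)
    (X : normedModType (scalar_field R F)) (T : X -> X) : Prop :=
  exists2 C : R, 0 < C &
    forall (x : X) (f : {linear X -> (scalar_field R F)^o}),
      bounded_linear f ->
      forall n : nat, (1 <= n)%N ->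
        n%:R^-1 * \sum_(0 <= k < n) rnorm (f (iter k T x))
          <= C * rnorm x * dual_norm f.

Definition hypercyclic (X : topologicalType) (T : X -> X) : Prop :=
  exists x : X, dense (range (fun n : nat => iter n T x)).

Definition chaotic (X : topologicalType) (T : X -> X) : Prop :=
  hypercyclic T /\
  dense [set x : X | exists2 n : nat, (1 <= n)%N & iter n T x = x].

(* At N = 0 the ratio is 0 / 0 = 0, which affects neither limit. *)
Definition density_ratio (R : realType) (A : set nat) (N : nat) : R :=
  #|[set k : 'I_N | `[< A k >]]|%:R / N%:R.

Definition upper_density (R : realType) (A : set nat) : \bar R :=
  limn_esup (fun N : nat => (density_ratio R A N)%:E).

Definition lower_density (R : realType) (A : set nat) : \bar R :=
  limn_einf (fun N : nat => (density_ratio R A N)%:E).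

Definition return_set (X : Type) (T : X -> X) (x : X) (U : set X) : set nat :=
  [set n : nat | U (iter n T x)].

Definition upper_frequently_hypercyclic (R : realType) (X : topologicalType)
    (T : X -> X) : Prop :=
  exists x : X, forall U : set X, U !=set0 -> open U ->
    (0 < upper_density R (return_set T x U))%E.

Definition frequently_hypercyclic (R : realType) (X : topologicalType)
    (T : X -> X) : Prop :=
  exists x : X, forall U : set X, U !=set0 -> open U ->
    (0 < lower_density R (return_set T x U))%E.

(* Main.v *)
Require Import Defs.
From HB Require Import structures.
From mathcomp Require Import complex ring lra.
Import Order.TTheory GRing.Theory Num.Theory.

(** For a bounded functional [f], put S_n(y) = sum_(k < n) |f (T^k y)|. Strong
    Cesàro boundedness says S_n(y) <= K n |y|. If [x] has a dense orbit, the
    averages S_n(x) / n and S_n(T^m x) / n have the same limit superior, which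
    is at most K |T^m x| for every m, hence 0; by density and Lipschitz
    continuity S_n(y) / n tends to 0 for every [y]. If f is nonzero, a periodic
    vector in the open set |f| > 1 has averages bounded below, and visits of
    [x] to this set with positive upper density keep S_n(x) / n away from 0.
    A nonzero bounded functional comes from the Hahn-Banach theorem. *)

Set Implicit Arguments.
Unset Strict Implicit.
Unset Printing Implicit Defensive.

Local Open Scope classical_set_scope.
Local Open Scope ring_scope.

(** * Sublinear functionals and their pointwise infima *)

Definition sublinear (R : realType) (V : lmodType R) (q : V -> R) : Prop :=
  (forall x y, q (x + y) <= q x + q y) /\
  (forall t x, 0 < t -> q (t *: x) <= t * q x).

Definition pointwise_inf (R : realType) (V : Type) (H : set (V -> R))
    (x : V) : R :=
  inf [set h x | h in H].

Section PointwiseInf.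
Variables (R : realType) (V : lmodType R) (H : set (V -> R)).
Hypothesis H0 : H !=set0.
Hypothesis Hlb : forall x, exists b, forall h, H h -> b <= h x.

Lemma pointwise_inf_le h x : H h -> pointwise_inf H x <= h x.
Proof.
move=> Hh; apply: ge_inf; last by exists h.
by have [b bP] := Hlb x; exists b => _ [g Hg <-]; exact: bP.
Qed.

Lemma le_pointwise_inf x b :
  (forall h, H h -> b <= h x) -> b <= pointwise_inf H x.
Proof.
move=> bP; apply: lb_le_inf => [|_ [h Hh <-]]; last exact: bP.
by have [h Hh] := H0; exists (h x), h.
Qed.

(** The dominating [k] may depend on the points. In a chain it is the smaller of [g] and [h]; in the
    family behind a flattening, the parameters add up. *)
Lemma pointwise_inf_sublinear :
  (forall g h x y, H g -> H h ->
    exists2 k, H k & k (x + y) <= g x + h y) ->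
  (forall h t x, H h -> 0 < t -> exists2 k, H k & k (t *: x) <= t * h x) ->
  sublinear (pointwise_inf H).
Proof.
move=> HD HZ; split=> [x y|t x t0].
  rewrite -lerBlDl; apply: le_pointwise_inf => h Hh.
  rewrite lerBlDl -lerBlDr; apply: le_pointwise_inf => g Hg.
  rewrite lerBlDr; have [k Hk] := HD g h x y Hg Hh.
  by apply: le_trans; exact: pointwise_inf_le.
rewrite -ler_pdivrMl//; apply: le_pointwise_inf => h Hh.
rewrite ler_pdivrMl//; have [k Hk] := HZ h t x Hh t0.
by apply: le_trans; exact: pointwise_inf_le.
Qed.

End PointwiseInf.

(** * Flattening a sublinear functional along a vector *)

Section Sublinear.
Variables (R : realType) (V : lmodType R) (q : V -> R).
Hypothesis qs : sublinear q.

Lemma sublinear0_ge0 : 0 <= q 0.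
Proof. by case: qs => /(_ 0 0); rewrite addr0; lra. Qed.

Lemma sublinear0 : q 0 = 0.
Proof.
have := sublinear0_ge0; have [_ /(_ 2^-1 0)] := qs.
by rewrite scaler0 invr_gt0 ltr0n => /(_ isT); lra.
Qed.

Lemma sublinearN_le x : - q (- x) <= q x.
Proof.
by have := sublinear0_ge0; case: qs => /(_ x (- x)); rewrite subrr; lra.
Qed.

(** For [t > 0], the assumed inequality used with the factor [t^-1] gives the reverse one. *)
Lemma sublinear_ge0Z t x : 0 <= t -> t * q x <= q (t *: x).
Proof.
rewrite le_eqVlt => /predU1P[<-|t0].
  by rewrite scale0r mul0r sublinear0_ge0.
rewrite -ler_pdivlMl//; case: qs => _ /(_ t^-1 (t *: x)).
by rewrite invr_gt0 scalerA mulVf ?gt_eqF// scale1r; exact.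
Qed.

Let flat (y : V) : set (V -> R) :=
  [set (fun x => q (x + t *: y) - t * q y) | t in [set t : R | 0 <= t]].

(* The largest sublinear functional below [q] whose value at [- y] is at most
   [- q y]. *)
Definition flatten_along (y : V) : V -> R := pointwise_inf (flat y).

Let flat0 y : flat y !=set0.
Proof. by exists (fun x => q (x + 0 *: y) - 0 * q y), 0 => /=. Qed.

Let flat_lb y x : exists b, forall h, flat y h -> b <= h x.
Proof.
(* The bound is uniform in [t], since [t * q y <= q (t *: y) <= q (x + t *: y) + q (- x)]. *)
exists (- q (- x)) => _ [t /= t0 <-].
have := sublinear_ge0Z y t0; have [+ _] := qs => /(_ (x + t *: y) (- x)).
by rewrite addrAC subrr add0r; lra.
Qed.

Lemma flatten_along_sublinear y : sublinear (flatten_along y).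
Proof.
have [qD qZ] := qs; apply: (pointwise_inf_sublinear (flat0 y) (flat_lb y)).
  move=> _ _ x z [t /= t0 <-] [s /= s0 <-].
  exists (fun x => q (x + (t + s) *: y) - (t + s) * q y).
    by exists (t + s) => //=; exact: addr_ge0.
  by have := qD (x + t *: y) (z + s *: y); rewrite addrACA -scalerDl; lra.
move=> _ t x [s /= s0 <-] t0.
exists (fun x => q (x + (t * s) *: y) - (t * s) * q y).
  by exists (t * s) => //=; rewrite mulr_ge0// ltW.
by have := qZ t (x + s *: y) t0; rewrite scalerDr scalerA; lra.
Qed.

Lemma flatten_along_le y x t :
  0 <= t -> flatten_along y x <= q (x + t *: y) - t * q y.
Proof.
move=> t0; have Ht : flat y (fun x => q (x + t *: y) - t * q y) by exists t.
exact: (pointwise_inf_le (flat_lb y) x Ht).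
Qed.

Lemma flatten_along_le_id y x : flatten_along y x <= q x.
Proof.
by have := flatten_along_le y x (lexx 0); rewrite scale0r mul0r addr0 subr0.
Qed.

End Sublinear.

(** * The real Hahn-Banach theorem by minimal sublinear functionals *)

Section HahnBanach.
Variables (R : realType) (V : lmodType R).

Lemma exists_minimal_sublinear (p : V -> R) : sublinear p ->
  exists q, [/\ sublinear q, forall x, q x <= p x &
    forall r, sublinear r -> (forall x, r x <= q x) -> r = q].
Proof.
move=> ps.
pose T := {q : V -> R | sublinear q /\ forall x, q x <= p x}.
pose t0 : T := exist _ p (conj ps (fun x => lexx (p x))).
(* The order is reversed, so that Zorn's lemma yields a minimal functional; a nonempty chain is
   bounded by its pointwise infimum, the empty one by [p]. *)
pose ge (s t : T) := `[< forall x, sval t x <= sval s x >].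
have [||A Atot|[q [qs qp]] qmin] := @ZL_preorder T t0 ge.
- by move=> t; apply/asboolP.
- move=> r s t /asboolP rs /asboolP st; apply/asboolP => x.
  exact: le_trans (st x) (rs x).
- have [[a Aa]|/forallNP A0] := pselect (A !=set0); last first.
    by exists t0 => s /A0.
  pose H := [set sval t | t in A].
  have H0 : H !=set0 by exists (sval a), a.
  have Hlb x : exists b, forall h, H h -> b <= h x.
    exists (- p (- x)) => _ [[h [hs hp]] _ <-] /=.
    by have := sublinearN_le hs x; have := hp (- x); lra.
  have Hs : sublinear (pointwise_inf H).
    apply: pointwise_inf_sublinear => //.
      move=> _ _ x y [s As <-] [t At <-].
      have [/asboolP st|/asboolP ts] := Atot _ _ As At.
        exists (sval t); first by exists t.
        have := st x; have [+ _] := proj1 (svalP t) => /(_ x y); lra.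
      exists (sval s); first by exists s.
      have := ts y; have [+ _] := proj1 (svalP s) => /(_ x y); lra.
    move=> _ t x [s As <-] tgt0; exists (sval s); first by exists s.
    by have [_] := proj1 (svalP s); exact.
  have Hp x : pointwise_inf H x <= p x.
    apply: le_trans (proj2 (svalP a) x).
    by apply: pointwise_inf_le => //; exists a.
  exists (exist (fun q => sublinear q /\ forall x, q x <= p x) _ (conj Hs Hp)).
  move=> s As; apply/asboolP => x /=.
  by apply: pointwise_inf_le => //; exists s.
- exists q; split=> // r rs rq; apply/funext => x; apply/eqP.
  have rp y : r y <= p y by exact: le_trans (rq y) (qp y).
  have /asboolP := qmin (exist _ r (conj rs rp)) (introT (asboolP _) rq).
  by move=> /(_ x) /= qr; rewrite eq_le rq qr.
Qed.

(* A minimal sublinear [q] equals each of its flattenings, which makes it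
   additive; starting from the flattening of [p] along [x0] pins the value at
   [x0]. *)
Lemma hahn_banach (p : V -> R) (x0 : V) : sublinear p ->
  exists f : {linear V -> R^o}, (forall x, f x <= p x) /\ p x0 <= f x0.
Proof.
move=> ps.
have [q [qs qp qmin]] :=
  exists_minimal_sublinear (flatten_along_sublinear ps x0).
have qD x y : q (x + y) = q x + q y.
  apply/eqP; rewrite eq_le (proj1 qs) /=.
  (* By minimality the flattening along [y] is [q] itself; the parameter 1 then gives
     [q x <= q (x + y) - q y]. *)
  have := flatten_along_le qs y x ler01.
  rewrite (qmin _ (flatten_along_sublinear qs y) (flatten_along_le_id qs y)).
  by rewrite scale1r mul1r lerBrDr.
have q0 : q 0 = 0 by exact: sublinear0.
have qN x : q (- x) = - q x by have := qD x (- x); rewrite subrr; lra.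
have qZ_gt0 t x : 0 < t -> q (t *: x) = t * q x.
  move=> t0; apply/eqP; rewrite eq_le (proj2 qs)//=.
  exact: sublinear_ge0Z (ltW t0).
have qZ t x : q (t *: x) = t * q x.
  have [t0|t0|->] := ltgtP t 0; last by rewrite scale0r mul0r.
    by apply: oppr_inj; rewrite -qN -scaleNr qZ_gt0 ?oppr_gt0// mulNr.
  exact: qZ_gt0.
have qlin : linear (q : V -> R^o) by move=> t x y; rewrite qD qZ.
pose f : {linear V -> R^o} :=
  HB.pack_for {linear V -> R^o} q (GRing.isLinear.Build R V R^o *:%R q qlin).
exists f; split=> [x|].
  exact: le_trans (qp x) (flatten_along_le_id ps x0 x).
(* At [- x0] the parameter 1 gives [q (- x0) <= p 0 - p x0 = - p x0]. *)
have := le_trans (qp (- x0)) (flatten_along_le ps x0 (- x0) ler01).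
by rewrite scale1r addNr sublinear0// mul1r qN /=; lra.
Qed.

End HahnBanach.

(** * From real functionals to complex ones *)

Definition realified (R : realType) (V : lmodType R[i]) : Type := V.

Section Realified.
Variables (R : realType) (V : lmodType R[i]).

HB.instance Definition _ := GRing.Zmodule.on (realified V).

Let scale (t : R) (x : realified V) : realified V := (t%:C)%C *: (x : V).

Let scaleA a b x : scale a (scale b x) = scale (a * b) x.
Proof. by rewrite /scale scalerA rmorphM. Qed.

Let scale1 : left_id 1 scale.
Proof. by move=> x; rewrite /scale rmorph1 scale1r. Qed.

Let scaleDr : right_distributive scale +%R.
Proof. by move=> t x y; exact: scalerDr. Qed.

Let scaleDl x : {morph scale^~ x : a b / a + b}.
Proof. by move=> a b; rewrite /scale rmorphD scalerDl. Qed.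

HB.instance Definition _ := GRing.Zmodule_isLmodule.Build R (realified V)
  scaleA scale1 scaleDr scaleDl.

Lemma realifiedZ (t : R) (x : realified V) : t *: x = (t%:C)%C *: (x : V) :> V.
Proof. by []. Qed.

Variable g : {linear realified V -> R^o}.

(** The unique complex-linear functional with real part [g]. *)
Definition complexify (x : V) : R[i]^o := (g x +i* - g ('i%C *: x))%C.

Lemma complexify_linear : linear complexify.
Proof.
have gD (x y : V) : g (x + y) = g x + g y := raddfD g x y.
have gZ (t : R) (x : V) : g ((t%:C)%C *: x) = t * g x := linearZZ g t x.
have gE (c : R[i]) (x : V) :
    g (c *: x) = complex.Re c * g x + complex.Im c * g ('i%C *: x).
  by rewrite {1}[c]complexE scalerDl gD gZ ['i%C * _]mulrC -scalerA gZ.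
move=> c x y.
have e1 : g (c *: x + y) =
    complex.Re c * g x + complex.Im c * g ('i%C *: x) + g y.
  by rewrite gD gE.
have e2 : g ('i%C *: (c *: x + y)) =
    complex.Re ('i%C * c) * g x + complex.Im ('i%C * c) * g ('i%C *: x)
    + g ('i%C *: y).
  by rewrite [X in g X]scalerDr gD scalerA gE.
rewrite [LHS]/complexify e1 e2; apply/eqP; rewrite eq_complex.
case: c {e1 e2} => a b /=; apply/andP; split; apply/eqP; ring.
Qed.

End Realified.

(** * The real-valued norm and bounded functionals over both fields *)

Lemma rnorm_ge0 (R : realType) (F : scalars)
    (V : normedModType (scalar_field R F)) (v : V) : 0 <= rnorm v.
Proof.
case: F V v => V v; rewrite /rnorm /=; first exact: normr_ge0.
by have := normr_ge0 v; rewrite lecE => /andP[].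
Qed.

Lemma ler_rnormD (R : realType) (F : scalars)
    (V : normedModType (scalar_field R F)) (v w : V) :
  rnorm (v + w) <= rnorm v + rnorm w.
Proof.
case: F V v w => V v w; rewrite /rnorm /=; first exact: ler_normD.
by have := ler_normD v w; rewrite lecE -raddfD => /andP[].
Qed.

Lemma rnormN (R : realType) (F : scalars)
    (V : normedModType (scalar_field R F)) (v : V) : rnorm (- v) = rnorm v.
Proof. by rewrite /rnorm normrN. Qed.

Lemma rnormMn (R : realType) (F : scalars)
    (V : normedModType (scalar_field R F)) (v : V) n :
  rnorm (v *+ n) = rnorm v *+ n.
Proof. by rewrite /rnorm normrMn; case: F V v => V v; rewrite //= raddfMn. Qed.

(** Over the complex numbers, nonnegativity of the norm forces its imaginary part to vanish, so the
    real part detects zero. *)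
Lemma rnorm_eq0 (R : realType) (F : scalars)
    (V : normedModType (scalar_field R F)) (v : V) : rnorm v = 0 -> v = 0.
Proof.
case: F V v => V v; rewrite /rnorm /= => v0; apply: normr0_eq0 => //.
have := normr_ge0 v; rewrite lecE v0 => /andP[/eqP].
by case: `|v| v0 => a b /= -> ->.
Qed.

Lemma rnormZ_complex (R : realType)
    (V : normedModType (scalar_field R ComplexScalars)) (c : R[i]) (v : V) :
  rnorm (c *: v : V) =
  Num.sqrt (complex.Re c ^+ 2 + complex.Im c ^+ 2) * rnorm v.
Proof.
rewrite /rnorm normrZ normc_def.
by case: (`|v|) => a b; rewrite /= mul0r subr0.
Qed.

Lemma rnorm_gt0 (R : realType) (F : scalars)
    (V : normedModType (scalar_field R F)) (v : V) : v != 0 -> 0 < rnorm v.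
Proof.
move=> v0; rewrite lt_neqAle rnorm_ge0 andbT eq_sym.
by apply: contra_neq v0; exact: rnorm_eq0.
Qed.

Lemma nbhs_rnorm (R : realType) (F : scalars)
    (V : normedModType (scalar_field R F)) (v : V) (e : R) : 0 < e ->
  nbhs v [set w | rnorm (v - w) < e].
Proof.
case: F V v => V v e0; apply/nbhs_ballP; rewrite /nbhs_ball_ /=.
  by exists e => // w; rewrite -ball_normE.
exists (e%:C)%C; first by rewrite /= ltcE /= eqxx.
by move=> w; rewrite -ball_normE /= ltcE => /andP[].
Qed.

(** Hahn-Banach is applied to the norm at [v]; in the complex case the real functional obtained is
    then complexified. *)
Lemma exists_bounded_functional (R : realType) (F : scalars)
    (V : normedModType (scalar_field R F)) (v : V) : v != 0 ->
  exists2 f : {linear V -> (scalar_field R F)^o}, bounded_linear f & f v != 0.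
Proof.
move=> /rnorm_gt0; case: F V v => V v pv.
- have ps : sublinear (@rnorm R RealScalars V : V -> R).
    split=> [x y|t x t0]; first exact: ler_rnormD.
    by rewrite /rnorm /= normrZ gtr0_norm.
  have [f [fp fv]] := hahn_banach v ps.
  exists f; last by apply: contraTneq fv => ->; rewrite -ltNge.
  exists 1 => x; rewrite mul1r.
  have fn : - f x <= rnorm x by rewrite -raddfN -[rnorm x]rnormN fp.
  suff: `|f x| <= rnorm x by [].
  by rewrite ler_norml fp andbT lerNl.
- have ps : sublinear (@rnorm R ComplexScalars V : realified V -> R).
    split=> [x y|t x t0]; first exact: ler_rnormD.
    rewrite realifiedZ rnormZ_complex /= expr0n addr0 sqrtr_sqr.
    by rewrite gtr0_norm.
  have [g [gp gv]] := hahn_banach (v : realified V) ps.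
  have gn (x : V) : `|g x| <= rnorm x.
    by rewrite ler_norml gp andbT lerNl -(raddfN g) -[rnorm x]rnormN gp.
  pose f : {linear V -> R[i]^o} :=
    HB.pack_for {linear V -> R[i]^o} (complexify g)
      (GRing.isLinear.Build R[i] V R[i]^o *:%R _ (complexify_linear g)).
  exists f; last first.
    apply: contraTneq gv => /(congr1 (@complex.Re R)) /= ->.
    by rewrite -ltNge.
  (* Both components of [f x] are at most [rnorm x] in absolute value, so the modulus is at most
     twice that. *)
  exists 2 => x.
  have gx := gn x.
  have gix : `|g ('i%C *: x)| <= rnorm x.
    have := gn ('i%C *: x).
    by rewrite rnormZ_complex /= expr0n add0r expr1n sqrtr1 mul1r.
  have -> : rnorm (f x : (scalar_field R ComplexScalars)^o) =
    Num.sqrt (g x ^+ 2 + (- g ('i%C *: x)) ^+ 2) by [].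
  move: gx gix (rnorm_ge0 x); rewrite !ler_norml.
  move: (g x) (g _) (rnorm x) => a b N /andP[? ?] /andP[? ?] N0.
  rewrite -[2 * N]ger0_norm ?mulr_ge0// -sqrtr_sqr ler_wsqrtr//; nra.
Qed.

Lemma bounded_linear_gt0 (R : realType) (F : scalars)
    (V W : normedModType (scalar_field R F)) (f : {linear V -> W}) :
  bounded_linear f ->
  exists2 M : R, 0 < M & forall x, rnorm (f x) <= M * rnorm x.
Proof.
move=> [M fM]; exists (`|M| + 1) => [|x]; first by rewrite ltr_wpDl.
apply: le_trans (fM x) _; rewrite ler_wpM2r ?rnorm_ge0//.
by rewrite (le_trans (ler_norm M))// lerDl.
Qed.

Lemma continuous_rnorm_functional (R : realType) (F : scalars)
    (V : normedModType (scalar_field R F))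
    (f : {linear V -> (scalar_field R F)^o}) :
  bounded_linear f -> continuous (fun x => rnorm (f x) : R).
Proof.
move=> /bounded_linear_gt0[M M0 fM] x; apply/cvgrPdist_lt => e e0.
have eM0 : 0 < e / M by exact: divr_gt0.
apply: filterS (nbhs_rnorm x eM0) => y /=; rewrite ltr_pdivlMr// => xy.
have fxy : rnorm (f (x - y)) < e.
  by apply: le_lt_trans (fM _) _; rewrite mulrC.
have := ler_rnormD (f (x - y)) (f y); have := ler_rnormD (f (y - x)) (f x).
rewrite -!raddfD !subrK -[rnorm (f (y - x))]rnormN -raddfN opprB.
by move=> fy fx; rewrite ltr_norml; apply/andP; split; lra.
Qed.

(** * Sums of a functional along orbits *)

Section OrbitSums.
Variables (R : realType) (F : scalars).
Variables (X : normedModType (scalar_field R F)) (T : {linear X -> X}).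
Variable f : {linear X -> (scalar_field R F)^o}.

Definition orbit_sum (n : nat) (x : X) : R :=
  \sum_(0 <= k < n) rnorm (f (iter k T x)).

Lemma iter_linearD k (x y : X) : iter k T (x + y) = iter k T x + iter k T y.
Proof. by elim: k => //= k ->; rewrite raddfD. Qed.

Lemma orbit_sumD n x y : orbit_sum n (x + y) <= orbit_sum n x + orbit_sum n y.
Proof.
rewrite /orbit_sum -big_split; apply: ler_sum => k _ /=.
by rewrite iter_linearD raddfD; exact: ler_rnormD.
Qed.

Lemma orbit_sum_ge0 n x : 0 <= orbit_sum n x.
Proof. by apply: sumr_ge0 => k _; exact: rnorm_ge0. Qed.

Lemma orbit_sum_addn m n x :
  orbit_sum (m + n) x = orbit_sum m x + orbit_sum n (iter m T x).
Proof.
rewrite /orbit_sum (big_cat_nat (n := m)) ?leq_addr//=; congr (_ + _).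
rewrite -{1}[m]add0n big_addn addKn.
by apply: eq_bigr => k _; rewrite iterD.
Qed.

Hypothesis cesaroT : strongly_cesaro_bounded T.
Hypothesis boundedf : bounded_linear f.

(** The absolute value and the added 1 make the constant positive, so that later estimates can
    divide by it. *)
Lemma orbit_sum_le : exists2 K : R, 0 < K &
  forall n x, orbit_sum n x <= K * n%:R * rnorm x.
Proof.
have [C C0 TC] := cesaroT; exists (C * `|dual_norm f| + 1).
  by rewrite ltr_wpDl// mulr_ge0// ltW.
move=> [|n] x; first by rewrite /orbit_sum big_geq// mulr0 mul0r.
have := TC x f boundedf n.+1 isT; rewrite -/(orbit_sum n.+1 x).
rewrite ler_pdivrMl// => /le_trans; apply.
rewrite [_ * n.+1%:R]mulrC -[leRHS]mulrA ler_wpM2l//.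
have := rnorm_ge0 x; have := ler_norm (dual_norm f).
move: (rnorm x) (dual_norm f) => N d dN N0.
have : C * N * d <= C * N * `|d| by rewrite ler_wpM2l// mulr_ge0// ltW.
lra.
Qed.

Variable x : X.
Hypothesis densex : dense (range (fun n => iter n T x)).

Lemma orbit_approx (y : X) (e : R) : 0 < e ->
  exists m, rnorm (y - iter m T x) < e.
Proof.
move=> e0.
have [||z [/interior_subset yz [m _ mz]]] :=
    densex (O := interior [set z | rnorm (y - z) < e]).
- by exists y; exact: nbhs_rnorm.
- exact: open_interior.
- by exists m; rewrite mz.
Qed.

(** Three contributions of at most [e / 3 * n%:R]: the distance from [y] to an orbit point, the
    growth of the sums at [x], and constants absorbed for large [n]. *)
Lemma orbit_sum_small (y : X) (e : R) : 0 < e ->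
  \forall n \near \oo, orbit_sum n y <= e * n%:R.
Proof.
have [K K0 SK] := orbit_sum_le.
(* The orbit of [x] comes close to [0], so the averages at [x] are small. *)
have Sx (d : R) : 0 < d -> exists b, forall n, orbit_sum n x <= b + d * n%:R.
  move=> d0; have [m] := orbit_approx 0 (divr_gt0 d0 K0).
  rewrite sub0r rnormN ltr_pdivlMr// => mlt.
  (* The first [m] terms form the constant; the rest is a sum at [iter m T x], of norm below
     [d / K]. *)
  exists (orbit_sum m x) => n.
  have : orbit_sum n x <= orbit_sum (m + n) x.
    by rewrite addnC orbit_sum_addn lerDl orbit_sum_ge0.
  rewrite orbit_sum_addn => /le_trans; apply; rewrite lerD2l.
  by apply: le_trans (SK _ _) _; rewrite mulrAC ler_wpM2r// mulrC ltW.
move=> e0; have e3 : 0 < e / 3 by lra.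
have [m] := orbit_approx y (divr_gt0 e3 K0); rewrite ltr_pdivlMr// => ymlt.
have [b Sb] := Sx _ e3.
near=> n.
have Sym : orbit_sum n (y - iter m T x) <= e / 3 * n%:R.
  by apply: le_trans (SK _ _) _; rewrite mulrAC ler_wpM2r// mulrC ltW.
have Sxm : orbit_sum n (iter m T x) <= b + e / 3 * m%:R + e / 3 * n%:R.
  have := Sb (m + n)%N; rewrite orbit_sum_addn natrD.
  have := orbit_sum_ge0 m x; lra.
have := orbit_sumD n (y - iter m T x) (iter m T x); rewrite subrK.
have : b + e / 3 * m%:R <= e / 3 * n%:R.
  rewrite -ler_pdivrMl//; near: n; exact: nbhs_infty_ger.
lra.
Unshelve. all: by end_near.
Qed.

End OrbitSums.

(** * Densities of return sets *)

Lemma density_ratio_ge0 (R : realType) (A : set nat) N :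
  0 <= density_ratio R A N.
Proof. by rewrite divr_ge0. Qed.

(** A Markov inequality: [a] dominates the indicator of [A]. *)
Lemma density_ratio_le (R : realType) (A : set nat) (a : nat -> R) N :
  (forall k, 0 <= a k) -> (forall k, A k -> 1 <= a k) ->
  density_ratio R A N <= (\sum_(0 <= k < N) a k) / N%:R.
Proof.
move=> a0 a1; apply: ler_wpM2r; first by rewrite invr_ge0.
rewrite -sum1_card natr_sum big_mkord big_mkcond /=.
apply: ler_sum => k _; case: ifPn => // kA; apply: a1.
  by move: kA; rewrite inE /= => /asboolP.
Qed.

Lemma upper_density0 (R : realType) (A : set nat) :
  (forall e : R, 0 < e -> \forall N \near \oo, density_ratio R A N <= e) ->
  upper_density R A = 0%E.
Proof.
move=> A0; apply: (cvg_limn_einf_sup _).2.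
apply: cvg_EFin; first exact: nearW.
apply/cvgrPdist_le => e /A0; apply: filterS => N AN.
by rewrite sub0r normrN ger0_norm ?density_ratio_ge0.
Qed.

Lemma frequently_hypercyclic_upper (R : realType) (X : topologicalType)
    (T : X -> X) :
  frequently_hypercyclic R T -> upper_frequently_hypercyclic R T.
Proof.
move=> [x xP]; exists x => U U0 oU.
exact: lt_le_trans (xP U U0 oU) (limn_einf_sup _).
Qed.

Lemma dense_orbit_upper_density (R : realType) (X : topologicalType)
    (T : X -> X) (x : X) :
  (forall U : set X, U !=set0 -> open U ->
    (0 < upper_density R (return_set T x U))%E) ->
  dense (range (fun n => iter n T x)).
Proof.
move=> xP U U0 oU; apply: contrapT => UT.
have := xP U U0 oU; rewrite upper_density0 ?ltxx// => e e0; apply: nearW => N.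
(* The return set is empty, so even the zero function dominates its indicator. *)
have TxU k : return_set T x U k -> 1 <= 0 :> R.
  by move=> Uk; case: UT; exists (iter k T x); split=> //; exists k.
have := density_ratio_le (a := fun=> 0) N (fun=> lexx 0) TxU.
by rewrite big1// mul0r => /le_trans; apply; exact: ltW.
Qed.

Theorem corollary4p7 (R : realType) (F : scalars)
    (X : completeNormedModType (scalar_field R F))
    (nontrivialX : exists x : X, x != 0)
    (T : {linear X -> X}) (boundedT : bounded_linear T)
    (cesaroT : strongly_cesaro_bounded T) :
  ~ chaotic T /\
  ~ upper_frequently_hypercyclic R T /\
  ~ frequently_hypercyclic R T.
Proof.
have [v v0] := nontrivialX.
have [f fb fv] := exists_bounded_functional v0.
pose U := [set z : X | 1 < rnorm (f z)].
have oU : open U.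
  rewrite -[U]/((fun z => rnorm (f z)) @^-1` [set r : R | 1 < r]).
  apply: open_comp; last exact: open_gt.
  by move=> z _; exact: continuous_rnorm_functional.
have U0 : U !=set0.
  have fv0 := rnorm_gt0 fv; set r := rnorm _ in fv0.
  have ri : 0 <= r^-1 by rewrite invr_ge0 ltW.
  (* [Num.bound r^-1] exceeds [r^-1]; a natural multiple serves both scalar fields at once. *)
  exists (v *+ Num.bound r^-1); rewrite /U /= raddfMn rnormMn -/r.
  by rewrite -mulr_natr -ltr_pdivrMl// mulr1 archi_boundP.
suff ufhc : ~ upper_frequently_hypercyclic R T.
  split; last by split=> // /frequently_hypercyclic_upper.
  move=> [[x xd] /(_ U U0 oU)[y [Uy [p p1 py]]]].
  have p0 : 0 < p%:R :> R by rewrite ltr0n.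
  (* Each period starts at [y], which lies in [U], and so adds at least 1. *)
  have Sy j : j%:R <= orbit_sum T f (j * p) y.
    elim: j => [|j IHj]; first exact: orbit_sum_ge0.
    rewrite mulSn orbit_sum_addn py -natr1 addrC lerD//.
    case: p p1 {py p0 IHj} => // p _.
    rewrite /orbit_sum big_nat_recl//= (le_trans (ltW Uy))// lerDl.
    by apply: sumr_ge0 => k _; exact: rnorm_ge0.
  have ep : 0 < (2 * p%:R)^-1 :> R by rewrite invr_gt0 mulr_gt0.
  have [N _ SN] := orbit_sum_small cesaroT fb xd y ep.
  (* At the index [N.+1 * p] the upper bound is half of [N.+1], while [Sy] gives at least [N.+1];
     the successor keeps this number positive and the contradiction strict. *)
  have /SN := leq_trans (leqnSn N) (leq_pmulr N.+1 p1).
  apply/negP; rewrite -ltNge; apply: lt_le_trans (Sy _).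
  rewrite natrM mulrCA invfM -[_ / _ * _]mulrA mulVf ?gt_eqF// mulr1.
  by rewrite gtr_pMr// invf_lt1 ?ltr1n.
move=> [x xP].
have xd := dense_orbit_upper_density xP.
have := xP U U0 oU; rewrite upper_density0 ?ltxx// => e e0.
near=> N.
(* Each visit to [U] contributes more than 1, so the frequency of visits is at most the average of
   [orbit_sum] at [x], which tends to 0. *)
apply: le_trans
  (density_ratio_le (a := fun k => rnorm (f (iter k T x))) _ _ _) _.
- by move=> k; exact: rnorm_ge0.
- by move=> k /ltW.
rewrite ler_pdivrMr; last by rewrite ltr0n; near: N; exact: nbhs_infty_gt.
near: N; exact: (orbit_sum_small cesaroT fb xd x e0).
Unshelve. all: by end_near.
Qed.
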